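(* Let the hypergraph $\mathcal H$ with node set $C$ and edges $C_1,\dots,C_\ell$ be an arbitrary connected hypergraph, let $\rho_1,\dots,\rho_\ell>0$ with $\sum_r\rho_r=1$ be the probabilities of the i.i.d. cluster selection $r(t)\in\{1,\dots,\ell\}$ in the algorithm $$q_C(t+1)=q_C(t)-(\Omega_{r(t)}M\Omega_{r(t)})^\sharp(Mq_C(t)+Nq_{V\setminus C}),$$ and let $\beta=\max\{|\lambda|:\lambda\text{ eigenvalue of }F_{\mathrm{ave}},\ \lambda\ne1\}$, where $F_{\mathrm{ave}}=\sum_{r=1}^\ell\rho_rF_r$ and $F_r=I-(\Omega_rM\Omega_r)^\sharp M$. Then $$\beta\ge1-\frac{\left(\sum_{r=1}^\ell\rho_r|C_r|\right)-1}{m-1}.$$ In case all the sets $C_r$ have the same cardinality $c$, i.e. $|C_r|=c$ for all $r$, then $$\beta\ge1-\frac{c-1}{m-1}.$$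
   Context: Let $G$ be a finite directed graph with node set $V$, $|V|=n$, a distinguished node $0$, and edge set $E$ (each edge $e$ going from $\sigma(e)$ to $\tau(e)$), connected irrespective of edge orientation. $A\in\{0,\pm1\}^{|E|\times n}$ is the incidence matrix: $[A]_{ev}=-1$ if $v=\sigma(e)$, $1$ if $v=\tau(e)$, $0$ otherwise. Each edge has an impedance $z_e\in\mathbb{C}$ with $\mathrm{Re}(z_e)>0$; $Z=\mathrm{diag}(z_e)$, $L=A^TZ^{-1}A$, and $X\in\mathbb{C}^{n\times n}$ is the unique symmetric matrix with $XL=I-\mathbf{1}\mathbf{1}_0^T$, $X\mathbf{1}_0=0$ (with $\mathbf{1}$ the all-ones vector, $\mathbf{1}_0$ the basis vector of node $0$). $C\subseteq V$ is the set of compensators, $m=|C|\ge2$. Ordering the nodes of $C$ first, $q=(q_C,q_{V\setminus C})\in\mathbb{R}^n$ and $\mathrm{Re}(X)=\begin{bmatrix}M&N\\N^T&Q\end{bmatrix}$ with $M\in\mathbb{R}^{m\times m}$. The clusters $C_1,\dots,C_\ell$ are nonempty, possibly overlapping subsets of $C$ with $\bigcup_rC_r=C$. Vectors in $\mathbb{R}^m$ are indexed by $C$; $\mathbf{1}_{C_r}$ is the indicator vector of $C_r$, $\Omega_r:=\mathrm{diag}(\mathbf{1}_{C_r})-\frac{1}{|C_r|}\mathbf{1}_{C_r}\mathbf{1}_{C_r}^T$, and $\sharp$ denotes the Moore–Penrose pseudoinverse. A hypergraph is connected if any two nodes are joined by a chain of hyperedges in which consecutive hyperedges intersect. *)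

(* Defs.v *)
(* MathComp / MathComp-Analysis, with complex numbers R[i] from real-closed. *)
From HB Require Import structures.
From mathcomp Require Import all_boot all_order all_algebra.
From mathcomp Require Import complex.
From mathcomp Require Import all_classical all_reals all_analysis.

Set Implicit Arguments.
Unset Strict Implicit.
Unset Printing Implicit Defensive.

Import Order.TTheory GRing.Theory Num.Theory.

Local Open Scope classical_set_scope.
Local Open Scope ring_scope.

(** A directed multigraph with nodes 'I_n and edges 'I_p is given by its source
    and target maps [sigma tau : 'I_p -> 'I_n]. *)

Definition undirected (n p : nat) (sigma tau : 'I_p -> 'I_n) : rel 'I_n :=
  [rel u v | [exists e, ((sigma e == u) && (tau e == v))
                     || ((sigma e == v) && (tau e == u))]].

Definition weakly_connected (n p : nat) (sigma tau : 'I_p -> 'I_n) : Prop :=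
  forall u v, connect (undirected sigma tau) u v.

(* The nested conditional is the incidence matrix only when there are no
   self-loops: on a loop, both the -1 and the 1 clause would apply. *)
Definition incidence (F : pzRingType) (n p : nat) (sigma tau : 'I_p -> 'I_n) :
  'M[F]_(p, n) :=
  \matrix_(e, v) if v == sigma e then -1 else if v == tau e then 1 else 0.

Definition laplacian (F : comUnitRingType) (n p : nat)
    (sigma tau : 'I_p -> 'I_n) (z : 'rV[F]_p) : 'M[F]_n :=
  (incidence F sigma tau)^T *m invmx (diag_mx z) *m incidence F sigma tau.

Definition ones (F : pzRingType) (n : nat) : 'cV[F]_n := const_mx 1.

(* These equations determine X when L is the Laplacian of a connected graph
   whose impedances have positive real parts. *)
Definition green_matrix (F : comUnitRingType) (n : nat) (v0 : 'I_n)
    (L X : 'M[F]_n) : Prop :=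
  [/\ X^T = X,
      X *m L = 1%:M - ones F n *m (delta_mx v0 0 : 'cV[F]_n)^T
    & X *m (delta_mx v0 0 : 'cV[F]_n) = 0].

(** Vectors indexed by a set D of nodes are indexed by 'I_#|D| through
    [enum_val]. *)

Definition Re_block (R : realType) (n : nat) (X : 'M[R[i]]_n)
    (D1 D2 : {set 'I_n}) : 'M[R]_(#|D1|, #|D2|) :=
  \matrix_(i, j) complex.Re (X (enum_val i) (enum_val j)).

Definition indicator (R : realType) (n : nat) (D K : {set 'I_n}) :
  'cV[R]_#|D| := \col_i (enum_val i \in K)%:R.

Definition Omega (R : realType) (n : nat) (D K : {set 'I_n}) : 'M[R]_#|D| :=
  diag_mx (indicator R D K)^T
  - (#|K|%:R)^-1 *: (indicator R D K *m (indicator R D K)^T).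

Definition moore_penrose (R : realType) (m n : nat)
    (A : 'M[R]_(m, n)) (B : 'M[R]_(n, m)) : Prop :=
  [/\ A *m B *m A = A, B *m A *m B = B,
      (A *m B)^T = A *m B & (B *m A)^T = B *m A].

Definition pinv (R : realType) (m n : nat) (A : 'M[R]_(m, n)) : 'M[R]_(n, m) :=
  xget 0 [set B | moore_penrose A B].

Lemma moore_penrose_unique (R : realType) (m n : nat) (A : 'M[R]_(m, n)) B B' :
  moore_penrose A B -> moore_penrose A B' -> B = B'.
Proof.
move=> [h1 h2 h3 h4] [k1 k2 k3 k4].
have E1 : A *m B = A *m B'.
  rewrite -h3 -{1}k1 -(mulmxA (A *m B') A B) trmx_mul h3 k3.
  by rewrite mulmxA h1.
have E2 : B *m A = B' *m A.
  rewrite -h4 -{1}k1 -(mulmxA A B' A) mulmxA trmx_mul h4 k4.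
  by rewrite -mulmxA (mulmxA A B A) h1.
by rewrite -h2 -mulmxA E1 mulmxA E2 k2.
Qed.

Lemma gram_unitmx (R : realType) (r n : nat) (U : 'M[R]_(r, n)) :
  row_free U -> U *m U^T \in unitmx.
Proof.
move=> Ufree; rewrite -row_free_unit -kermx_eq0.
apply/eqP/row_matrixP => i; rewrite row0; set v := row i _.
have vG : v *m (U *m U^T) = 0 by rewrite /v -row_mul mulmx_ker row0.
have w0 : v *m U = 0.
  have : (v *m U) *m (v *m U)^T = 0.
    by rewrite trmx_mul mulmxA -(mulmxA v) vG mul0mx.
  move=> /matrixP/(_ 0 0); rewrite !mxE => /eqP.
  rewrite psumr_eq0; last by move=> j _; rewrite !mxE -expr2 sqr_ge0.
  move=> /allP H; apply/rowP => j; rewrite [RHS]mxE; apply/eqP.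
  have := H j (mem_index_enum j).
  by rewrite [X in _ * X]mxE -expr2 sqrf_eq0.
by apply: (row_free_inj Ufree); rewrite w0 mul0mx.
Qed.

Lemma pinvP (R : realType) (m n : nat) (A : 'M[R]_(m, n)) :
  moore_penrose A (pinv A).
Proof.
suff [B hB] : exists B, moore_penrose A B.
  by apply: (@xgetPex _ 0 [set B | moore_penrose A B]); exists B.
have [k [L [U [-> Ufree Lfull]]]] : exists k (L : 'M[R]_(m, k))
    (U : 'M[R]_(k, n)),
  [/\ A = L *m U, row_free U & row_full L].
  exists (\rank A), (col_base A), (row_base A).
  by rewrite mulmx_base row_base_free col_base_full.
have GU : U *m U^T \in unitmx by apply: gram_unitmx.
have GL : L^T *m L \in unitmx.
  rewrite -{2}[L]trmxK; apply: gram_unitmx.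
  by rewrite /row_free mxrank_tr.
pose P := invmx (U *m U^T); pose Q := invmx (L^T *m L).
have PT : P^T = P by rewrite /P trmx_inv trmx_mul trmxK.
have QT : Q^T = Q by rewrite /Q trmx_inv trmx_mul trmxK.
pose B := U^T *m P *m Q *m L^T.
have AB : (L *m U) *m B = L *m Q *m L^T.
  rewrite /B !mulmxA -(mulmxA L U) -(mulmxA L (U *m U^T)) mulmxV //.
  by rewrite mulmx1.
have BA : B *m (L *m U) = U^T *m P *m U.
  rewrite /B -!mulmxA; congr (_ *m (_ *m _)).
  by rewrite !mulmxA -(mulmxA Q) mulVmx // mul1mx.
exists B; split.
- by rewrite AB mulmxA -(mulmxA (L *m Q)) -(mulmxA L) mulVmx // mulmx1.
- rewrite BA /B !mulmxA -(mulmxA (U^T *m P) U) -(mulmxA (U^T *m P)).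
  by rewrite mulmxV // mulmx1.
- by rewrite AB !trmx_mul trmxK QT mulmxA.
- by rewrite BA !trmx_mul trmxK PT mulmxA.
Qed.

(* Chain-connectedness of the hypergraph with node set D and edges K r. *)
Definition hyper_connected (n l : nat) (D : {set 'I_n})
    (K : 'I_l -> {set 'I_n}) : Prop :=
  forall u v, u \in D -> v \in D ->
  exists r s, [/\ u \in K r, v \in K s
    & connect [rel a b | K a :&: K b != finset.set0] r s].

Definition Fmat (R : realType) (n : nat) (X : 'M[R[i]]_n)
    (D K : {set 'I_n}) : 'M[R]_#|D| :=
  let M := Re_block X D D in
  1%:M - pinv (Omega R D K *m M *m Omega R D K) *m M.

Definition Fave (R : realType) (n l : nat) (X : 'M[R[i]]_n) (D : {set 'I_n})
    (K : 'I_l -> {set 'I_n}) (rho : 'I_l -> R) : 'M[R]_#|D| :=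
  \sum_r rho r *: Fmat X D (K r).

(* Since the index set is finite, independence of the selections amounts to the
   product rule for the atoms of every finite subfamily of times. *)
Definition iid_selection (R : realType) (d : measure_display)
    (T : measurableType d) (P : probability T R) (l : nat) (rho : 'I_l -> R)
    (r : nat -> T -> 'I_l) : Prop :=
  [/\ forall t k, measurable (r t @^-1` [set k]),
      forall t k, P (r t @^-1` [set k]) = (rho k)%:E
    & forall (J : seq nat) (k : nat -> 'I_l), uniq J ->
        P (\bigcap_(t in [set` J]) (r t @^-1` [set k t]))
        = (\prod_(t <- J) rho (k t))%:E].

Definition algorithm (R : realType) (T : Type) (n l : nat) (X : 'M[R[i]]_n)
    (D : {set 'I_n}) (K : 'I_l -> {set 'I_n}) (r : nat -> T -> 'I_l)
    (qD : nat -> T -> 'cV[R]_#|D|) (qDc : 'cV[R]_#|~: D|) : Prop :=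
  let M := Re_block X D D in
  let N := Re_block X D (~: D) in
  forall t w,
    let O := Omega R D (K (r t w)) in
    qD t.+1 w = qD t w - pinv (O *m M *m O) *m (M *m qD t w + N *m qDc).

(* Moduli of the complex eigenvalues of F other than 1. *)
Definition moduli_ne1 (R : realType) (m : nat) (F : 'M[R]_m) : set R :=
  [set complex.Re `|lambda| | lambda in
    [set a : R[i] | eigenvalue (map_mx (real_complex R) F) a /\ a != 1]].

Definition is_max (R : realType) (S : set R) (b : R) : Prop :=
  S b /\ ubound S b.

(* Main.v *)
(** Put M for the C-block of Re X and P_r = Omega_r M Omega_r.  Since M is
    positive definite on the space S of sum-zero vectors, P_r^# P_r = Omega_r,
    so E_r = P_r^# M has trace |C_r| - 1.  Hence E = sum_r rho_r E_r = I - F_ave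
    has trace s = sum_r rho_r |C_r| - 1 and image inside S, and connectedness of
    the hypergraph makes E injective on S.  The m - 1 eigenvalues of E on S are
    therefore nonzero and sum to s, so one of them, a, satisfies
    Re a <= s / (m - 1), and 1 - a is an eigenvalue of F_ave other than 1 with
    |1 - a| >= 1 - s / (m - 1).  That the spectrum is real is never needed. *)

Require Import Defs.
From HB Require Import structures.
From mathcomp Require Import all_boot all_order all_algebra.
From mathcomp Require Import complex.
From mathcomp Require Import all_classical all_reals all_analysis.

Set Implicit Arguments.
Unset Strict Implicit.
Unset Printing Implicit Defensive.

Import Order.TTheory GRing.Theory Num.Theory.

Local Open Scope ring_scope.

(** * Real parts of complex numbers *)

Lemma ReD (R : realType) (a b : R[i]) :
  complex.Re (a + b) = complex.Re a + complex.Re b.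
Proof. by case: a; case: b. Qed.

Lemma Re_sum (R : realType) (I : Type) (s : seq I) (Q : pred I) (F : I -> R[i]) :
  complex.Re (\sum_(i <- s | Q i) F i) = \sum_(i <- s | Q i) complex.Re (F i).
Proof. by apply: (big_morph _ (@ReD R)). Qed.

Lemma ReM_real (R : realType) (a : R) (b : R[i]) :
  complex.Re (real_complex R a * b) = a * complex.Re b.
Proof. by case: b => x y /=; rewrite mul0r subr0. Qed.

Lemma ReMr_real (R : realType) (a : R) (b : R[i]) :
  complex.Re (b * real_complex R a) = complex.Re b * a.
Proof. by rewrite mulrC ReM_real mulrC. Qed.

Lemma ReJ (R : realType) (a : R[i]) : complex.Re (conjc a) = complex.Re a.
Proof. by case: a. Qed.

Lemma Re_inv_gt0 (R : realType) (a : R[i]) :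
  0 < complex.Re a -> 0 < complex.Re a^-1.
Proof.
case: a => x y /= x0; rewrite divr_gt0 //.
by rewrite ltr_pwDl ?exprn_gt0 // sqr_ge0.
Qed.

(** * Positivity of the real part of [X] on sum-zero vectors *)

(** Definiteness on all vectors would be too much to ask: [X] kills the basis vector of [v0], so its
    real part is singular. *)
Definition sum0_posdef (R : realType) (m : nat) (M : 'M[R]_m) : Prop :=
  forall x : 'cV[R]_m, (ones R m)^T *m x = 0 -> x != 0 ->
  0 < (x^T *m M *m x) 0 0.

Lemma invmx_diag_mx (F : fieldType) (p : nat) (z : 'rV[F]_p) :
  (forall e, z 0 e != 0) -> invmx (diag_mx z) = diag_mx (map_mx GRing.inv z).
Proof.
move=> z0.
have zV : diag_mx z *m diag_mx (map_mx GRing.inv z) = 1%:M.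
  by apply/matrixP => i j; rewrite mul_diag_mx !mxE mulrnAr divff.
have [zu _] := mulmx1_unit zV.
by rewrite -[RHS]mul1mx -(mulVmx zu) -mulmxA zV mulmx1.
Qed.

Lemma tr_laplacian (F : fieldType) (n p : nat) (sigma tau : 'I_p -> 'I_n)
    (z : 'rV[F]_p) :
  (laplacian sigma tau z)^T = laplacian sigma tau z.
Proof.
rewrite /laplacian; move: (incidence F sigma tau) => A.
by rewrite 2!trmx_mul trmxK trmx_inv tr_diag_mx mulmxA.
Qed.

(** Transpose of the equation for [X *m L]. In this form [X] is a right inverse of [L] on sum-zero
    vectors. *)
Lemma green_matrix_mull (F : fieldType) (n : nat) (v0 : 'I_n) (L X : 'M[F]_n) :
  L^T = L -> green_matrix v0 L X ->
  L *m X = 1%:M - (delta_mx v0 0 : 'cV_n) *m (ones F n)^T.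
Proof.
move=> LT [XT XL _].
by rewrite -[LHS]trmxK trmx_mul LT XT XL linearB /= trmx1 trmx_mul trmxK.
Qed.

(* With u = X w one has L u = w, so w^T X w is the power sum over the edges of
   conj(1 / z_e) * |(A u)_e|^2, whose terms have nonnegative real part. *)
Lemma green_sum0_posdef (R : realType) (n p : nat) (sigma tau : 'I_p -> 'I_n)
    (v0 : 'I_n) (z : 'rV[R[i]]_p) (X : 'M[R[i]]_n) :
  (forall e, 0 < complex.Re (z 0 e)) ->
  green_matrix v0 (laplacian sigma tau z) X ->
  sum0_posdef (map_mx (@complex.Re R) X).
Proof.
move=> zpos [XT XL X0] w w_sum0 w0.
pose A := incidence R[i] sigma tau; pose wC := map_mx (real_complex R) w.
have zn0 e : z 0 e != 0 by apply: contraTneq (zpos e) => ->; rewrite ltxx.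
pose D := diag_mx (map_mx GRing.inv z).
have LE : laplacian sigma tau z = A^T *m D *m A.
  by rewrite /laplacian invmx_diag_mx.
have LX := green_matrix_mull (tr_laplacian sigma tau z) (And3 XT XL X0).
have onesC : (ones R[i] n)^T = map_mx (real_complex R) (ones R n)^T.
  by apply/matrixP => i j; rewrite !mxE.
pose u := X *m wC; pose y := A *m u.
have Lu : A^T *m (D *m y) = wC.
  rewrite /y !mulmxA -LE LX mulmxBl mul1mx -mulmxA onesC.
  by rewrite -map_mxM w_sum0 map_mx0 mulmx0 subr0.
have quad : (w^T *m map_mx (@complex.Re R) X *m w) 0 0
    = complex.Re ((wC^T *m u) 0 0).
  rewrite -mulmxA /u !mxE Re_sum; apply: eq_bigr => i _.
  rewrite !mxE ReM_real Re_sum; congr (_ * _).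
  by apply: eq_bigr => j _; rewrite !mxE ReMr_real.
have AJ : map_mx (@conjc R) A = A.
  apply/matrixP => e v; rewrite !mxE.
  by do 2?[case: ifP => _]; rewrite ?rmorphN ?rmorph1 ?rmorph0.
have wJ : map_mx (@conjc R) wC = wC.
  by apply/matrixP => i j; rewrite !mxE conjc_real.
have Dy e : (D *m y) e 0 = (z 0 e)^-1 * y e 0.
  by rewrite mul_diag_mx mxE [X in X * _]mxE.
have powerE : complex.Re ((wC^T *m u) 0 0)
    = \sum_e complex.Re (z 0 e)^-1
             * (complex.Re (y e 0) ^+ 2 + complex.Im (y e 0) ^+ 2).
  (* As [wC] is real, it may be replaced by its conjugate, that is, by the conjugate of
     [A^T *m (D *m y)]. This pairs each [y e 0] with its own conjugate. *)
  rewrite -wJ -Lu map_mxM -map_trmx AJ trmx_mul trmxK -mulmxA -/y mxE Re_sum.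
  apply: eq_bigr => e _; do 2!rewrite [X in complex.Re (X * _)]mxE.
  rewrite Dy rmorphM /= -mulrA [_^* * y e 0]mulrC -sqr_normc -add_Re2_Im2.
  by rewrite ReMr_real ReJ.
have term_ge0 e : 0 <= complex.Re (z 0 e)^-1
    * (complex.Re (y e 0) ^+ 2 + complex.Im (y e 0) ^+ 2).
  by rewrite mulr_ge0 ?addr_ge0 ?sqr_ge0 ?ltW ?Re_inv_gt0.
rewrite quad powerE lt0r sumr_ge0 ?andbT //.
(* Zero total power forces [y = 0], and then [w = 0] by [Lu]. *)
apply: contra w0; rewrite psumr_eq0 // => /allP all0.
have y0 : y = 0.
  apply/matrixP => e j; rewrite ord1 [RHS]mxE; apply/eqP.
  have /implyP/(_ isT) := all0 e (mem_index_enum _).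
  rewrite mulf_eq0 gt_eqF ?Re_inv_gt0 //= paddr_eq0 ?sqr_ge0 // !sqrf_eq0.
  by rewrite eq_complex.
apply/eqP/matrixP => i j; rewrite [RHS]mxE.
apply: complexI; have /matrixP/(_ i j) := Lu.
by rewrite y0 !mulmx0 !mxE => <-.
Qed.

Lemma Re_block_sum0_posdef (R : realType) (n : nat) (X : 'M[R[i]]_n)
    (D : {set 'I_n}) :
  sum0_posdef (map_mx (@complex.Re R) X) -> sum0_posdef (Re_block X D D).
Proof.
move=> Xpos x x_sum0 x0.
(* [J] extends a vector on [D] by zero to all nodes; it is injective and preserves coordinate
   sums. *)
pose J : 'M[R]_(n, #|D|) := \matrix_(v, i) (v == enum_val i)%:R.
have mulJ q (Y : 'M[R]_(q, n)) i j : (Y *m J) i j = Y i (enum_val j).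
  rewrite mxE (bigD1 (enum_val j)) //= mxE eqxx mulr1 big1 ?addr0 // => k kj.
  by rewrite mxE (negPf kj) mulr0.
have blockE : Re_block X D D = J^T *m map_mx (@complex.Re R) X *m J.
  apply/matrixP => i j; rewrite mulJ -[J^T *m _]trmxK trmx_mul trmxK [RHS]mxE.
  by rewrite mulJ !mxE.
have onesJ : (ones R n)^T *m J = (ones R #|D|)^T.
  by apply/matrixP => i j; rewrite mulJ !mxE.
have JJ : J^T *m J = 1%:M.
  by apply/matrixP => i j; rewrite mulJ !mxE (inj_eq enum_val_inj) eq_sym.
have -> : x^T *m Re_block X D D *m x
    = (J *m x)^T *m map_mx (@complex.Re R) X *m (J *m x).
  by rewrite blockE trmx_mul !mulmxA.
apply: Xpos; first by rewrite mulmxA onesJ.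
by apply: contraNneq x0 => Jx0; rewrite -[x]mul1mx -JJ -mulmxA Jx0 mulmx0.
Qed.

(** * Eigenvalues bounded by the trace *)

(** The trace is the sum of the [k] roots of the characteristic polynomial, and their real parts
    cannot all exceed their average. *)
Lemma exists_eigenvalue_Re_le_trace (R : realType) (k : nat) (W : 'M[R[i]]_k) :
  (0 < k)%N ->
  exists2 a, eigenvalue W a & complex.Re a * k%:R <= complex.Re (\tr W).
Proof.
move=> k0; have [s sE] := closed_field_poly_normal (char_poly W).
rewrite (monicP (char_poly_monic W)) scale1r in sE.
have sz : size s = k.
  by apply/eqP; rewrite -eqSS -(size_prod_XsubC s id) -sE size_char_poly.
have trE : \tr W = \sum_(a <- s) a.
  apply: oppr_inj; rewrite -char_poly_trace // sE -{1}sz.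
  by rewrite coefPn_prod_XsubC // sz -lt0n.
suff [a as_ leq_a] : exists2 a, a \in s &
    complex.Re a * k%:R <= complex.Re (\tr W).
  by exists a => //; rewrite eigenvalue_root_char sE root_prod_XsubC.
apply: contrapT => no_root.
have lt_a a : a \in s -> complex.Re (\tr W) / k%:R < complex.Re a.
  move=> as_; rewrite ltr_pdivrMr ?ltr0n // ltNge; apply/negP => le_a.
  by apply: no_root; exists a.
have : \sum_(a <- s) (complex.Re a - complex.Re (\tr W) / k%:R) == 0.
  rewrite sumrB -Re_sum -trE big_const_seq count_predT sz iter_addr_0.
  by rewrite -[_ *+ k]mulr_natr divfK ?subrr // pnatr_eq0 -lt0n.
rewrite big_seq psumr_eq0 => [/allP all0|a /lt_a]; last by rewrite subr_ge0 => /ltW.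
have [a as_] : exists a, a \in s.
  by case: (s) sz k0 => [<- //|b t _ _]; exists b; rewrite mem_head.
have := all0 a as_; rewrite as_ /= subr_eq0 => /eqP aE.
by have := lt_a a as_; rewrite aE ltxx.
Qed.

(** [U *m V] and [V *m U] have the same trace and the same nonzero eigenvalues. Averaging over the
    smaller, invertible matrix [V *m U] gives the divisor [k] and excludes the eigenvalue 0. *)
Lemma exists_nz_eigenvalue_Re_le_trace (R : realType) (m k : nat)
    (U : 'M[R]_(m, k)) (V : 'M[R]_(k, m)) :
  (0 < k)%N -> V *m U \in unitmx ->
  exists a : R[i], [/\ eigenvalue (map_mx (real_complex R) (U *m V)) a, a != 0
    & complex.Re a * k%:R <= \tr (U *m V)].
Proof.
move=> k0 VU.
have [a /eigenvalueP [v vE v0] aRe] :=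
  exists_eigenvalue_Re_le_trace (map_mx (real_complex R) (V *m U)) k0.
have VUC : map_mx (real_complex R) (V *m U) \in unitmx by rewrite map_unitmx.
have a0 : a != 0.
  apply: contraNneq v0 => a0; move: vE; rewrite a0 scale0r => vE.
  by rewrite -[v](mulmxK VUC) vE mul0mx.
rewrite map_mxM mulmxA in vE.
exists a; split=> //.
  apply/eigenvalueP; exists (v *m map_mx (real_complex R) V).
    by rewrite map_mxM mulmxA vE -scalemxAl.
  apply: contraNneq v0 => vV0; move: vE.
  by rewrite vV0 mul0mx => /esym/eqP; rewrite scaler_eq0 (negPf a0).
by rewrite mxtrace_mulC; move: aRe; rewrite trace_map_mx.
Qed.

Lemma exists_nz_eigenvalue_sum0 (R : realType) (m : nat) (E : 'M[R]_m) :
  (2 <= m)%N -> (ones R m)^T *m E = 0 ->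
  (forall x : 'cV[R]_m, (ones R m)^T *m x = 0 -> E *m x = 0 -> x = 0) ->
  exists a : R[i], [/\ eigenvalue (map_mx (real_complex R) E) a, a != 0
    & complex.Re a * (m%:R - 1) <= \tr E].
Proof.
move=> m2 onesE E_inj; set e := ones R m in onesE E_inj *.
have rk_e : \rank e = 1%N.
  apply/eqP; rewrite eqn_leq rank_leq_col lt0n mxrank_eq0; apply/eqP.
  move=> /matrixP/(_ (Ordinal (ltnW m2)) 0) /eqP.
  by rewrite !mxE oner_eq0.
have rk : \rank (kermx e) = m.-1 by rewrite mxrank_ker rk_e subn1.
(* The columns of [B^T] form a basis of the sum-zero vectors. Since the image of [E] consists of
   such vectors, [E] factors as [B^T *m D^T], and [D^T *m B^T] is the matrix of [E] restricted to
   them. *)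
pose B := row_base (kermx e).
have [D ED] : exists D, E^T = D *m B.
  apply/submxP; rewrite eq_row_base; apply/sub_kermxP.
  by apply: trmx_inj; rewrite trmx_mul trmxK onesE trmx0.
have {}ED : E = B^T *m D^T by rewrite -trmx_mul -ED trmxK.
have Be : B *m e = 0 by apply/sub_kermxP; rewrite eq_row_base.
have [||a [aE a0 aRe]] := @exists_nz_eigenvalue_Re_le_trace _ _ _ B^T D^T.
- by rewrite rk -ltnS prednK // ltnW.
- rewrite -trmx_mul unitmx_tr -row_free_unit -kermx_eq0.
  (* If [x] is in the left kernel of [B *m D], then [(x *m B)^T] is a sum-zero vector killed by [E],
     so [x *m B = 0]. *)
  apply/eqP/row_matrixP => i; rewrite row0; set x := row i _.
  have xBD : x *m B *m D = 0 by rewrite -mulmxA /x -row_mul mulmx_ker row0.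
  apply: (row_free_inj (row_base_free (kermx e))); rewrite mul0mx -/B.
  apply: trmx_inj; rewrite trmx0; apply: E_inj.
    by rewrite -trmx_mul -mulmxA Be mulmx0 trmx0.
  by rewrite ED -mulmxA -trmx_mul xBD trmx0 mulmx0.
have rkE : (\rank (kermx e))%:R = m%:R - 1 :> R.
  by rewrite rk -subn1 natrB // ltnW.
by exists a; rewrite ED -rkE.
Qed.

(** * Existence of the maximum modulus *)

Lemma is_max_finite (R : realType) (s : seq R) (S : set R) (b : R) :
  S b -> (forall x, S x -> x \in s) -> exists2 c, is_max S c & b <= c.
Proof.
move=> Sb Ss.
pose t := [seq x <- s | `[< S x >]].
have inT x : (x \in t) = `[< S x >].
  rewrite mem_filter; case: (asboolP (S x)) => //= Sx; exact: Ss.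
have bt : b \in t by rewrite inT; apply/asboolP.
(* Starting the fold at [b], an element of [S], keeps its value in [S]. *)
pose c := \big[Order.max/b]_(x <- t) x.
have c_ge x : S x -> x <= c.
  move=> Sx; apply: (le_bigmax_seq b x xpredT id) => //.
  by rewrite inT; apply/asboolP.
exists c; last exact: c_ge.
split; last by move=> x; exact: c_ge.
rewrite /c big_seq; apply: big_ind => //.
- by move=> x y Sx Sy; rewrite maxEle; case: ifP.
- by move=> x; rewrite inT => /asboolP.
Qed.

Lemma moduli_ne1_finite (R : realType) (m : nat) (F : 'M[R]_m) :
  exists s : seq R, forall x, moduli_ne1 F x -> x \in s.
Proof.
pose FC := map_mx (real_complex R) F.
have [s sE] := closed_field_poly_normal (char_poly FC).
exists [seq complex.Re `|a| | a <- s] => x [a [aF _] <-]; apply: map_f.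
move: aF; rewrite eigenvalue_root_char sE (monicP (char_poly_monic FC)).
by rewrite scale1r root_prod_XsubC.
Qed.

(** The witness is [1 - a], which differs from 1 because [a] is nonzero; its modulus is at least its
    real part. It also makes the finite set of moduli nonempty. *)
Lemma exists_max_moduli_ne1 (R : realType) (m : nat) (E : 'M[R]_m) (a : R[i]) :
  eigenvalue (map_mx (real_complex R) E) a -> a != 0 ->
  exists2 b, is_max (moduli_ne1 (1%:M - E)) b & 1 - complex.Re a <= b.
Proof.
move=> /eigenvalueP [v vE v0] a0.
have [s sP] := moduli_ne1_finite (1%:M - E).
have [|b bmax le_b] := is_max_finite (b := complex.Re `|1 - a|) _ sP.
  exists (1 - a) => //; split.
    apply/eigenvalueP; exists v => //.
    by rewrite map_mxB map_mx1 mulmxBr mulmx1 vE scalerBl scale1r.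
  by apply: contra a0 => /eqP/(congr1 (fun x => 1 - x)); rewrite subKr subrr => ->.
exists b => //; apply: le_trans le_b.
have := normc_ge_Re (1 - a); rewrite lecE => /andP[_ /=].
by apply: le_trans; case: (a) => x y /=; exact: ler_norm.
Qed.

(** * The cluster projections [Omega] *)

Section Omega.
Variables (R : realType) (n : nat) (D K : {set 'I_n}).
Hypotheses (KD : K \subset D) (K0 : K != finset.set0).

Let e := indicator R D K.

Lemma tr_Omega : (Omega R D K)^T = Omega R D K.
Proof.
by rewrite /Omega linearB /= tr_diag_mx linearZ /= trmx_mul trmxK.
Qed.

Lemma sum_indicator : \sum_i e i 0 = #|K|%:R.
Proof.
transitivity (\sum_(v in D) (v \in K)%:R : R).
  by rewrite [RHS]big_enum_val; apply: eq_bigr => i _; rewrite mxE.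
rewrite -natr_sum -big_mkcondr /= -sum1_card; congr (_%:R).
by apply: eq_bigl => v; apply: andb_idl; apply/fintype.subsetP.
Qed.

Lemma indicator_dot : e^T *m e = (#|K|%:R)%:M.
Proof.
apply/matrixP => i j; rewrite !ord1 !mxE eqxx mulr1n -sum_indicator.
by apply: eq_bigr => k _; rewrite !mxE; case: (_ \in K); rewrite ?mulr1 ?mulr0.
Qed.

Lemma cardK_neq0 : #|K|%:R != 0 :> R.
Proof. by rewrite pnatr_eq0 cards_eq0. Qed.

Lemma Omega_indicator : Omega R D K *m e = 0.
Proof.
rewrite /Omega mulmxBl -scalemxAl -mulmxA indicator_dot mul_mx_scalar.
rewrite scalerA mulVf ?cardK_neq0 // scale1r.
apply/matrixP => i j; rewrite ord1 mul_diag_mx !mxE.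
by case: (_ \in K); rewrite ?mulr1 ?mulr0 subrr.
Qed.

Lemma ones_Omega : (ones R #|D|)^T *m Omega R D K = 0.
Proof.
have -> : (ones R #|D|)^T *m Omega R D K
    = e^T - (#|K|%:R)^-1 *: ((ones R #|D|)^T *m e *m e^T).
  rewrite mulmxBr -scalemxAr mulmxA; congr (_ - _).
  by apply/matrixP => i j; rewrite ord1 mul_mx_diag !mxE mul1r.
have -> : (ones R #|D|)^T *m e = (#|K|%:R)%:M.
  apply/matrixP => i j; rewrite !ord1 !mxE eqxx mulr1n -sum_indicator.
  by apply: eq_bigr => k _; rewrite !mxE mul1r.
by rewrite mul_scalar_mx scalerA mulVf ?cardK_neq0 // scale1r subrr.
Qed.

(** Together with [tr_Omega], this makes [Omega] an orthogonal projection: restrict to [K], then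
    subtract the mean over [K]. *)
Lemma Omega_idem : Omega R D K *m Omega R D K = Omega R D K.
Proof.
rewrite {2}/Omega mulmxBr -scalemxAr mulmxA Omega_indicator mul0mx scaler0 subr0.
have eT0 : e^T *m diag_mx e^T = e^T.
  apply/matrixP => i j; rewrite mul_mx_diag !mxE.
  by case: (_ \in K); rewrite ?mulr1 ?mulr0.
rewrite /Omega mulmxBl -scalemxAl -mulmxA eT0; congr (_ - _).
apply/matrixP => i j; rewrite mul_diag_mx !mxE.
by case: (_ \in K); rewrite ?mul1r ?mul0r ?mul0rn.
Qed.

Lemma mxtrace_Omega : \tr (Omega R D K) = #|K|%:R - 1.
Proof.
rewrite /Omega linearB /= linearZ /= mxtrace_diag mxtrace_mulC indicator_dot.
rewrite mxtrace_scalar mulr1n mulVf ?cardK_neq0 //; congr (_ - _).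
by rewrite -sum_indicator; apply: eq_bigr => i _; rewrite mxE.
Qed.

(** On [K], the equation says that each entry of [y] equals the mean of [y] over [K]. *)
Lemma Omega_ker (y : 'cV[R]_#|D|) i j : Omega R D K *m y = 0 ->
  enum_val i \in K -> enum_val j \in K -> y i 0 = y j 0.
Proof.
move=> Oy iK jK.
have Ey : diag_mx e^T *m y = (#|K|%:R)^-1 *: (e *m (e^T *m y)).
  by apply/eqP; rewrite -subr_eq0 mulmxA scalemxAl -mulmxBl -/e Oy.
suff yc k : enum_val k \in K -> y k 0 = (#|K|%:R)^-1 * (e^T *m y) 0 0.
  by rewrite !yc.
move=> kK; have /matrixP/(_ k 0) := Ey; rewrite mul_diag_mx !mxE big_ord1.
by rewrite !mxE kK !mul1r.
Qed.

End Omega.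

(** * The pseudoinverse of a compression [O *m M *m O] *)

(** Transposition exchanges the two symmetry equations. With uniqueness, this yields the symmetry of
    the pseudoinverse. *)
Lemma moore_penrose_tr (R : realType) (m : nat) (A B : 'M[R]_m) :
  A^T = A -> moore_penrose A B -> moore_penrose A B^T.
Proof.
move=> AT [h1 h2 h3 h4]; split.
- by have := congr1 trmx h1; rewrite !trmx_mul AT mulmxA.
- by have := congr1 trmx h2; rewrite !trmx_mul AT mulmxA.
- by rewrite trmx_mul trmxK AT -h4 trmx_mul AT.
- by rewrite trmx_mul trmxK AT -h3 trmx_mul AT.
Qed.

Section Pinv.
Variables (R : realType) (m : nat) (M O : 'M[R]_m).
Hypotheses (M_sym : M^T = M) (M_pos : sum0_posdef M).
Hypotheses (O_sym : O^T = O) (O_idem : O *m O = O).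
Hypothesis (O_sum0 : (ones R m)^T *m O = 0).

Let A := O *m M *m O.

(** The form of [A] at [x] is the form of [M] at the sum-zero vector [O *m x]. *)
Lemma compression_ker (x : 'cV[R]_m) : A *m x = 0 -> O *m x = 0.
Proof.
move=> Ax; apply/eqP; apply: contraT => Ox0.
have Ox_sum0 : (ones R m)^T *m (O *m x) = 0 by rewrite mulmxA O_sum0 mul0mx.
have := M_pos Ox_sum0 Ox0.
rewrite trmx_mul O_sym.
have -> : x^T *m O *m M *m (O *m x) = x^T *m (A *m x) by rewrite /A !mulmxA.
by rewrite Ax mulmx0 mxE ltxx.
Qed.

Lemma pinv_compression_mul : Defs.pinv A *m A = O.
Proof.
have [h1 _ _ h4] := Defs.pinvP A.
have AO : A *m O = A by rewrite /A -mulmxA O_idem.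
(* The columns of the second factor are killed by [A], hence by [O]. Transposing the resulting
   [O = O *m (pinv A *m A)] and using [A *m O = A] gives the claim. *)
have OBA : O *m (1%:M - Defs.pinv A *m A) = 0.
  apply/matrixP => i j; transitivity (col j (O *m (1%:M - Defs.pinv A *m A)) i 0).
    by rewrite [RHS]mxE.
  rewrite colE -mulmxA compression_ker ?mxE //.
  by rewrite mulmxA mulmxBr mulmx1 mulmxA h1 subrr mul0mx.
move: OBA; rewrite mulmxBr mulmx1 => /eqP; rewrite subr_eq0 => /eqP OBA.
by rewrite -[RHS]O_sym OBA trmx_mul h4 O_sym -mulmxA AO.
Qed.

Lemma tr_pinv_compression : (Defs.pinv A)^T = Defs.pinv A.
Proof.
have AT : A^T = A by rewrite /A !trmx_mul M_sym O_sym mulmxA.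
exact: moore_penrose_unique (moore_penrose_tr AT (Defs.pinvP A)) (Defs.pinvP A).
Qed.

Lemma mul_pinv_compression : A *m Defs.pinv A = O.
Proof.
have AT : A^T = A by rewrite /A !trmx_mul M_sym O_sym mulmxA.
by rewrite -[LHS]trmxK trmx_mul tr_pinv_compression AT pinv_compression_mul.
Qed.

Lemma compression_pinvl : O *m Defs.pinv A = Defs.pinv A.
Proof. by have [_ h2 _ _] := Defs.pinvP A; rewrite -pinv_compression_mul. Qed.

Lemma compression_pinvr : Defs.pinv A *m O = Defs.pinv A.
Proof.
by have [_ h2 _ _] := Defs.pinvP A; rewrite -mul_pinv_compression mulmxA.
Qed.

(** Both sides of [pinv A] absorb [O]; cycling one copy past [M] rebuilds [A], and [pinv A *m A] is
    [O]. *)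
Lemma mxtrace_pinv_compression : \tr (Defs.pinv A *m M) = \tr O.
Proof.
rewrite -compression_pinvl -compression_pinvr -!mulmxA mxtrace_mulC.
by rewrite -[in RHS]pinv_compression_mul {3}/A -!mulmxA.
Qed.

(** Since [B = B *m M *m B], the value is the form of [M] at [B *m y]. That vector has sum zero, and
    it is nonzero because [A] maps it to [O *m y]. *)
Lemma pinv_compression_gt0 (y : 'cV[R]_m) :
  O *m y != 0 -> 0 < (y^T *m Defs.pinv A *m y) 0 0.
Proof.
move=> Oy0.
pose B := Defs.pinv A.
have BMB : B *m M *m B = B.
  have [_ h2 _ _] := Defs.pinvP A; rewrite -[RHS]h2 -/B.
  rewrite -{1}[B]compression_pinvr -[X in _ *m X = _]compression_pinvl -/B.
  by rewrite [in RHS]/A !mulmxA.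
have -> : y^T *m B *m y = (B *m y)^T *m M *m (B *m y).
  by rewrite trmx_mul tr_pinv_compression -{1}BMB !mulmxA.
apply: M_pos; first by rewrite /B -compression_pinvl !mulmxA O_sum0 !mul0mx.
by apply: contraNneq Oy0 => By; rewrite -mul_pinv_compression -mulmxA By mulmx0.
Qed.

Lemma pinv_compression_ge0 (y : 'cV[R]_m) : 0 <= (y^T *m Defs.pinv A *m y) 0 0.
Proof.
have [Oy0|/pinv_compression_gt0/ltW//] := eqVneq (O *m y) 0.
by rewrite -compression_pinvr -!mulmxA Oy0 !mulmx0 mxE.
Qed.

End Pinv.

(** * Averaging over a connected hypergraph *)

Lemma hyper_connected_const (R : realType) (n l : nat) (D : {set 'I_n})
    (K : 'I_l -> {set 'I_n}) (y : 'cV[R]_#|D|) :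
  (forall k, K k \subset D) -> hyper_connected D K ->
  (forall k i j, enum_val i \in K k -> enum_val j \in K k -> y i 0 = y j 0) ->
  forall i j, y i 0 = y j 0.
Proof.
move=> KD Kconn yK i j.
have [a [b [ia jb /connectP [s sP bE]]]] := Kconn _ _ (enum_valP i) (enum_valP j).
elim: s a i ia sP bE => [|c s IH] a i ia /= => [_ ba|/andP[ac sP] bE].
  by apply: (yK a) => //; rewrite -ba.
(* A node shared by consecutive clusters carries the value of [y] from one to the next. *)
have [v /setIP[va vc]] := set0Pn _ ac.
have vD : v \in D by apply: (fintype.subsetP (KD a)).
pose i' := enum_rank_in vD v.
have i'E : enum_val i' = v by rewrite enum_rankK_in.
rewrite (yK a i i') ?i'E //.
by apply: (IH c) => //; rewrite i'E.
Qed.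

Section Average.
Variables (R : realType) (n l : nat) (X : 'M[R[i]]_n) (C : {set 'I_n}).
Variables (K : 'I_l -> {set 'I_n}) (rho : 'I_l -> R).
Let M := Re_block X C C.
Hypotheses (M_sym : M^T = M) (M_pos : sum0_posdef M).
Hypotheses (KC : forall k, K k \subset C) (K0 : forall k, K k != finset.set0).
Hypothesis Kconn : hyper_connected C K.
Hypotheses (rho_pos : forall k, 0 < rho k) (rho_sum : \sum_k rho k = 1).

Let O k := Omega R C (K k).
Let B k := Defs.pinv (O k *m M *m O k).
(** [G *m M] is the matrix [E] of the overview. The factor [G] is kept apart because it is positive
    semidefinite, so its kernel is the intersection of those of its summands. *)
Let G := \sum_k rho k *: B k.

Lemma FaveE : Fave X C K rho = 1%:M - G *m M.
Proof.
have -> : 1%:M = \sum_k rho k *: (1%:M : 'M[R]_#|C|).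
  by rewrite -scaler_suml rho_sum scale1r.
rewrite /Fave mulmx_suml -sumrB.
by apply: eq_bigr => k _; rewrite scalerBr scalemxAl.
Qed.

Let O_sym k : (O k)^T = O k. Proof. exact: tr_Omega. Qed.
Let O_idem k : O k *m O k = O k. Proof. exact: Omega_idem. Qed.
Let O_sum0 k : (ones R #|C|)^T *m O k = 0. Proof. exact: ones_Omega. Qed.

Lemma mxtrace_GM : \tr (G *m M) = \sum_k rho k * #|K k|%:R - 1.
Proof.
(* Writing the subtracted 1 as the sum of the probabilities allows a termwise comparison. *)
rewrite mulmx_suml raddf_sum /= -[X in _ - X]rho_sum -sumrB.
apply: eq_bigr => k _; rewrite -scalemxAl mxtraceZ.
rewrite (mxtrace_pinv_compression M_sym M_pos (O_sym k) (O_idem k) (O_sum0 k)).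
by rewrite mxtrace_Omega // mulrBr mulr1.
Qed.

Lemma ones_GM : (ones R #|C|)^T *m (G *m M) = 0.
Proof.
rewrite mulmxA mulmx_sumr big1 ?mul0mx // => k _.
rewrite -scalemxAr /B -(compression_pinvl M_pos (O_sym k) (O_idem k)) //.
by rewrite mulmxA O_sum0 mul0mx scaler0.
Qed.

Lemma G_ker (y : 'cV[R]_#|C|) : G *m y = 0 -> exists c, y = c *: ones R #|C|.
Proof.
move=> Gy.
have Oy k : O k *m y = 0.
  apply/eqP; apply: contraT => Ok_y.
  (* The form of [G] at [y] is a sum of nonnegative terms, and term [k] would be positive if
     [O k *m y] were nonzero. *)
  have : \sum_k rho k * (y^T *m B k *m y) 0 0 == 0.
    have -> : \sum_k rho k * (y^T *m B k *m y) 0 0 = (y^T *m (G *m y)) 0 0.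
      rewrite mulmxA mulmx_sumr mulmx_suml summxE.
      by apply: eq_bigr => j _; rewrite -scalemxAr -scalemxAl [RHS]mxE.
    by rewrite Gy mulmx0 mxE.
  rewrite psumr_eq0 => [/allP/(_ k (mem_index_enum k))|j _]; last first.
    apply: mulr_ge0; first exact: ltW.
    exact: (pinv_compression_ge0 M_sym M_pos (O_sym j) (O_idem j) (O_sum0 j)).
  rewrite /= gt_eqF // mulr_gt0 //.
  exact: (pinv_compression_gt0 M_sym M_pos (O_sym k) (O_idem k) (O_sum0 k)).
have yE : forall i j, y i 0 = y j 0.
  apply: (hyper_connected_const KC Kconn) => k i j.
  exact: (Omega_ker (D := C) (K := K k) (Oy k)).
(* The constant is read off at any index; without indices every constant serves. *)
case: (pickP 'I_#|C|) => [i0 _|no_i].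
  by exists (y i0 0); apply/matrixP => i j; rewrite ord1 !mxE mulr1.
by exists 0; apply/matrixP => i; have := no_i i.
Qed.

(** By [G_ker], [M *m x] is a multiple of the all-ones vector, hence orthogonal to the sum-zero [x];
    definiteness then forces [x = 0]. *)
Lemma GM_inj (x : 'cV[R]_#|C|) :
  (ones R #|C|)^T *m x = 0 -> G *m M *m x = 0 -> x = 0.
Proof.
move=> x_sum0; rewrite -mulmxA => /G_ker [c Mx].
apply/eqP; apply: contraT => /(M_pos x_sum0).
rewrite -mulmxA Mx -scalemxAr -[x^T *m _]trmxK trmx_mul trmxK x_sum0.
by rewrite trmx0 scaler0 mxE ltxx.
Qed.

End Average.

Theorem theorem9 (R : realType) (n p : nat) (sigma tau : 'I_p -> 'I_n)
  (v0 : 'I_n) (z : 'rV[R[i]]_p) (X : 'M[R[i]]_n)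
  (C : {set 'I_n}) (l : nat) (K : 'I_l -> {set 'I_n}) (rho : 'I_l -> R)
  (d : measure_display) (T : measurableType d) (P : probability T R)
  (r : nat -> T -> 'I_l) (qC : nat -> T -> 'cV[R]_#|C|)
  (qCc : 'cV[R]_#|~: C|)
  (no_loop : forall e, sigma e != tau e)
  (G_connected : weakly_connected sigma tau)
  (z_pos : forall e, 0 < complex.Re (z 0 e))
  (X_green : green_matrix v0 (laplacian sigma tau z) X)
  (m_ge2 : (2 <= #|C|)%N)
  (K_nonempty : forall k, K k != finset.set0)
  (K_cover : finset.cover [set K k | k : 'I_l]%SET = C)
  (H_connected : hyper_connected C K)
  (rho_pos : forall k, 0 < rho k)
  (rho_sum : \sum_k rho k = 1)
  (r_iid : iid_selection P rho r)
  (q_algo : algorithm X K r qC qCc) :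
  exists beta : R,
    [/\ is_max (moduli_ne1 (Fave X C K rho)) beta,
        1 - ((\sum_k rho k * #|K k|%:R) - 1) / (#|C|%:R - 1) <= beta
      & forall c : nat, (forall k, #|K k| = c) ->
          1 - (c%:R - 1) / (#|C|%:R - 1) <= beta].
Proof.
have Re_pos := green_sum0_posdef z_pos X_green.
have M_pos : sum0_posdef (Re_block X C C) by apply: Re_block_sum0_posdef.
have M_sym : (Re_block X C C)^T = Re_block X C C.
  by have [XT _ _] := X_green; apply/matrixP => i j; rewrite !mxE -{1}XT mxE.
have KC k : K k \subset C.
  apply/fintype.subsetP => v vk; rewrite -K_cover; apply/finset.bigcupP.
  by exists (K k) => //; apply: imset_f.
have m1 : 0 < #|C|%:R - 1 :> R by rewrite subr_gt0 ltr1n.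
have [a [aE a0 aRe]] := exists_nz_eigenvalue_sum0 m_ge2
  (ones_GM rho M_pos KC K_nonempty)
  (GM_inj M_sym M_pos KC K_nonempty H_connected rho_pos).
have [beta beta_max le_beta] := exists_max_moduli_ne1 aE a0.
have bound : 1 - ((\sum_k rho k * #|K k|%:R) - 1) / (#|C|%:R - 1) <= beta.
  apply: le_trans le_beta; rewrite lerD2l lerN2 ler_pdivlMr //.
  by apply: le_trans aRe _; rewrite (mxtrace_GM M_sym M_pos).
exists beta; split; [by rewrite (FaveE X C K rho_sum) | exact: bound | move=> c Kc].
(* With equal cardinalities the mean cluster size is [c], so the second bound is an instance of the
   first. *)
suff <- : \sum_k rho k * #|K k|%:R = c%:R by exact: bound.
rewrite -[RHS]mul1r -rho_sum mulr_suml.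
by apply: eq_bigr => k _; rewrite Kc.
Qed.
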